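(* Let $T$ be a tree that is not a path. Then the following statements are equivalent: (i) $\gamma_M(T)=\dim(T)+\gamma(T)$; (ii) $\dim(T)=\ell'(T)-|\mathcal S'(T)|$; (iii) every exterior major vertex $u$ of $T$ with $\mathrm{ter}(u)\ge 2$ is adjacent to each of its terminal vertices; (iv) every path joining two leaves of $T$ that are at distance greater than $2$ contains at least two major vertices.
   Context: All graphs are finite, simple, undirected and connected, with at least 2 vertices; $d(u,v)$ is the shortest-path distance. A set $S\subseteq V(G)$ is a resolving set if for all $x,y\in V(G)$ with $x\ne y$ there is $u\in S$ with $d(u,x)\neq d(u,y)$; $\dim(G)$ is the minimum size of a resolving set. A set $S$ is dominating if every vertex not in $S$ has a neighbor in $S$; $\gamma(G)$ is the minimum size of a dominating set. A metric-locating-dominating set (MLD-set) is a set that is both resolving and dominating; $\gamma_M(G)$ is the minimum size of an MLD-set. In a tree $T$: a leaf is a vertex of degree 1; a support vertex is a vertex adjacent to a leaf; a strong support vertex is a vertex adjacent to at least two leaves; $\mathcal S'(T)$ is the set of strong support vertices; $\ell'(T)$ is the number of leaves adjacent to a strong support vertex. A major vertex is a vertex of degree at least 3. A leaf $x$ is a terminal vertex of a major vertex $u$ if $u$ is the major vertex closest to $x$; $\mathrm{ter}(u)$ is the number of terminal vertices of $u$; $u$ is an exterior major vertex if $\mathrm{ter}(u)\ge 1$. *)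

(* Defs.v *)
From mathcomp Require Import all_boot.
Set Implicit Arguments. Unset Strict Implicit. Unset Printing Implicit Defensive.

Section Graph.
Variables (T : finType) (e : rel T).

Definition simple_graph : Prop := symmetric e /\ irreflexive e.

Definition connected_graph : Prop := forall x y : T, connect e x y.

Definition acyclic : Prop := forall c : seq T, ucycle e c -> size c <= 2.

Definition is_tree : Prop := connected_graph /\ acyclic.

Definition is_path_graph : Prop :=
  exists s : seq T, [/\ uniq s, forall x, x \in s &
    forall x y, e x y <->
      exists s1 s2, s = s1 ++ x :: y :: s2 \/ s = s1 ++ y :: x :: s2].

Definition walk_of_len (x y : T) (n : nat) : bool :=
  [exists p : n.-tuple T, path e x p && (last x p == y)].

(* shortest-path distance (well defined for connected graphs: the least n
   <= #|T| such that there is a walk of length n from x to y) *)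
Definition dist (x y : T) : nat := find (walk_of_len x y) (iota 0 #|T|).

Definition resolving (S : {set T}) : bool :=
  [forall x, forall y, (x != y) ==> [exists u in S, dist u x != dist u y]].

Definition dominating (S : {set T}) : bool :=
  [forall v, (v \notin S) ==> [exists u in S, e v u]].

(* minimum cardinality of a set satisfying P (every set has size <= #|T|) *)
Definition min_card (P : pred {set T}) : nat :=
  find (fun n => [exists S : {set T}, P S && (#|S| == n)]) (iota 0 #|T|.+1).

Definition metric_dim : nat := min_card resolving.
Definition domination_number : nat := min_card dominating.
Definition mld_number : nat :=
  min_card (fun S => resolving S && dominating S).

Definition deg (x : T) : nat := #|[set y | e x y]|.
Definition leaf (x : T) : bool := deg x == 1.
Definition strong_support (x : T) : bool := 2 <= #|[set y | e x y & leaf y]|.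
Definition strong_supports : {set T} := [set x | strong_support x].
Definition ell' : nat :=
  #|[set y | leaf y & [exists x, e x y && strong_support x]]|.

Definition major (x : T) : bool := 3 <= deg x.

Definition terminal (u x : T) : bool :=
  [&& leaf x, major u & [forall w, major w ==> (dist x u <= dist x w)]].

Definition ter (u : T) : nat := #|[set x | terminal u x]|.
Definition exterior_major (u : T) : bool := major u && (1 <= ter u).

End Graph.

(* Main.v *)
(* A nonempty set S resolves the tree iff it meets one of any two distinct
   branches hanging at a common vertex m: two such branches avoided by S have
   their roots unresolved, and conversely an unresolved pair yields such a fork
   at the midpoint of its path. Applied to twin leaves, this shows that S contains
   all but at most one leaf at each strong support vertex, so dim >= l' - |S'|.
   A dominating set together with all but one leaf at each strong support vertex
   is resolving, and conversely the leaves of an MLD-set can be traded for strong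
   support vertices; hence gamma_M = gamma + l' - |S'|, and (i) says
   dim <= l' - |S'|. Condition (iv) forces every branch containing a major vertex
   to contain a strong support vertex, and two branches without major vertices
   at a common vertex to be leaves, so that the leaves alone already resolve. *)
Require Import Defs.
From mathcomp Require Import all_boot.
From mathcomp Require Import zify.
Set Implicit Arguments. Unset Strict Implicit. Unset Printing Implicit Defensive.

(** * Minimum cardinalities *)

Lemma min_cardP (T : finType) (P : pred {set T}) (S0 : {set T}) : P S0 ->
  exists2 S, P S & #|S| = min_card P.
Proof.
move=> PS0; pose a n := [exists S : {set T}, P S && (#|S| == n)].
have has_a : has a (iota 0 #|T|.+1).
  apply/hasP; exists #|S0|; first by rewrite mem_iota /= ltnS max_card.
  by apply/existsP; exists S0; rewrite PS0 eqxx.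
have: a (min_card P).
  have := nth_find 0 has_a; rewrite nth_iota //.
  by rewrite has_find size_iota in has_a.
by rewrite {1}/a => /existsP[S /andP[PS /eqP cS]]; exists S.
Qed.

Lemma min_card_le (T : finType) (P : pred {set T}) (S : {set T}) :
  P S -> min_card P <= #|S|.
Proof.
move=> PS; rewrite leqNgt; apply/negP => lt.
have := before_find 0 lt; rewrite nth_iota ?ltnS ?max_card //.
by move/negbT/negP; apply; apply/existsP; exists S; rewrite PS eqxx.
Qed.

(** * Shortest-path distance in connected graphs *)

Section Distance.
Variables (T : finType) (e : rel T).
Hypotheses (e_sym : symmetric e) (e_conn : connected_graph e).
Local Notation d := (dist e).

Lemma walk_of_lenP x y n :
  reflect (exists p, [/\ path e x p, last x p = y & size p = n])
          (walk_of_len e x y n).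
Proof.
apply: (iffP existsP) => [[p /andP[pp /eqP lp]]|[p [pp lp /eqP sp]]].
  by exists p; rewrite size_tuple.
by exists (Tuple sp); rewrite pp lp eqxx.
Qed.

Lemma dist_le_path x y p : path e x p -> last x p = y -> d x y <= size p.
Proof.
move=> pp lp; rewrite leqNgt; apply/negP => lt.
(* [find] never exceeds the length of the searched list, so a walk shorter than [d x y] has a length
   inside the searched range. *)
have lt' : size p < #|T|.
  by apply: leq_trans lt _; rewrite /dist -[X in _ <= X](size_iota 0) find_size.
have := before_find 0 lt; rewrite nth_iota // => /negbT/negP; apply.
by apply/walk_of_lenP; exists p.
Qed.

Lemma dist_path x y : exists p, [/\ path e x p, last x p = y & size p = d x y].
Proof.
have /connectP[p0 pp0 ->] := e_conn x y.
(* A repetition-free walk has fewer than [#|T|] edges, so the search in [dist] does succeed. *)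
case/shortenP: pp0 => p pp up _.
have sp : size p < #|T| by rewrite -[_.+1]/(size (x :: p)) -(card_uniqP up) max_card.
have has_w : has (walk_of_len e x (last x p)) (iota 0 #|T|).
  by apply/hasP; exists (size p); [rewrite mem_iota | apply/walk_of_lenP; exists p].
have := nth_find 0 has_w; rewrite nth_iota; last by rewrite has_find size_iota in has_w.
by move/walk_of_lenP.
Qed.

Lemma dist_refl x : d x x = 0.
Proof. by apply/eqP; rewrite -leqn0; apply: (@dist_le_path x x [::]). Qed.

Lemma dist_eq0 x y : d x y = 0 -> x = y.
Proof. by have [[|z p] [_ /= <- <-]] := dist_path x y. Qed.

Lemma dist_edge x y : e x y -> d x y <= 1.
Proof. by move=> xy; apply: (@dist_le_path x y [:: y]) => //=; rewrite xy. Qed.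

Lemma dist_triangle y x z : d x z <= d x y + d y z.
Proof.
have [p [pp lp <-]] := dist_path x y; have [q [pq lq <-]] := dist_path y z.
by rewrite -size_cat; apply: dist_le_path; rewrite ?cat_path ?last_cat lp ?pp.
Qed.

Lemma path_rev x p : path e x p -> path e (last x p) (rev (belast x p)).
Proof. by rewrite rev_path (eq_path (e' := e)) // => a b; rewrite e_sym. Qed.

Lemma last_rev_belast x p : last (last x p) (rev (belast x p)) = x :> T.
Proof. by case: p => //= y p; rewrite rev_cons last_rcons. Qed.

Lemma dist_sym x y : d x y = d y x.
Proof.
suff le a b : d a b <= d b a by apply/eqP; rewrite eqn_leq !le.
have [p [pp lp <-]] := dist_path b a.
rewrite -(size_belast b p) -size_rev -lp.
by apply: dist_le_path; [exact: path_rev | exact: last_rev_belast].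
Qed.

Lemma resolving_setT : resolving e [set: T].
Proof.
apply/forallP=> x; apply/forallP=> y; apply/implyP=> xy.
apply/existsP; exists x; rewrite inE /= dist_refl eq_sym.
by apply: contra xy => /eqP/dist_eq0->.
Qed.

Lemma dominating_setT : dominating e [set: T].
Proof. by apply/forallP=> x; rewrite inE. Qed.

End Distance.

(** * Leaves, major vertices and strong support vertices *)

Section Degree.
Variables (T : finType) (e : rel T).
Hypothesis e_sym : symmetric e.

Lemma leaf_nb x y z : leaf e x -> e x y -> e x z -> y = z.
Proof.
move=> /cards1P[w N] xy xz.
have: y \in [set y | e x y] by rewrite inE.
have: z \in [set y | e x y] by rewrite inE.
by rewrite N !inE => /eqP-> /eqP->.
Qed.

Lemma leaf_intro x y : e x y -> (forall z, e x z -> z = y) -> leaf e x.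
Proof.
move=> xy N; apply/cards1P; exists y; apply/setP=> z; rewrite !inE.
by apply/idP/eqP=> [/N|->].
Qed.

Lemma leaf_nb_ex x : leaf e x -> exists y, e x y.
Proof. by move=> /cards1P[y N]; exists y; have:= set11 y; rewrite -N inE. Qed.

Lemma leaf_not_major x : leaf e x -> ~~ major e x.
Proof. by rewrite /leaf /major => /eqP->. Qed.

Lemma major_nb2 x m : major e x ->
  exists a b, [/\ e x a, e x b, a != m, b != m & a != b].
Proof.
rewrite /major /deg (cardsD1 m) => gt2.
have /card_gt1P[a [b [Ha Hb ab]]] : 1 < #|[set y | e x y] :\ m|.
  by move: gt2; case: (_ \in _) => /=; lia.
by move: Ha Hb; rewrite !inE => /andP[? ?] /andP[? ?]; exists a, b.
Qed.

Lemma nonmajor_nb x a b c : ~~ major e x -> e x a -> e x b -> a != b ->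
  e x c -> c = a \/ c = b.
Proof.
move=> nM xa xb ab xc; have [|nca] := eqVneq c a; first by left.
have [|ncb] := eqVneq c b; first by right.
case/negP: nM; apply: leq_trans (subset_leq_card (_ : c |: [set a; b] \subset _)).
  by rewrite cardsU1 cards2 ab !inE negb_or nca ncb.
by apply/subsetP=> z; rewrite !inE => /or3P[] /eqP->.
Qed.

Lemma strong_supportP x :
  reflect (exists a b, [/\ e x a, e x b, leaf e a, leaf e b & a != b])
          (strong_support e x).
Proof.
apply: (iffP card_gt1P) => [[a [b [+ + ab]]]|[a [b [xa xb la lb ab]]]].
  by rewrite !inE => /andP[? ?] /andP[? ?]; exists a, b.
by exists a, b; rewrite !inE xa xb la lb.
Qed.

End Degree.

(** * Branches of a tree *)

Section Tree.
Variables (T : finType) (e : rel T).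
Hypotheses (e_sym : symmetric e) (e_irr : irreflexive e).
Hypotheses (e_conn : connected_graph e) (e_acyc : acyclic e).
Local Notation d := (dist e).
Local Notation dC := (dist_sym e_sym e_conn).
Local Notation d0 := (dist_refl e).
Local Notation tri := (dist_triangle e_conn).

Lemma edge_neq x y : e x y -> x != y.
Proof. by apply: contraTneq => ->; rewrite e_irr. Qed.

(** [B] is what [v] still reaches once the edge is deleted; reaching [u] as well would close a
    cycle. *)
Lemma edge_cut u v : e u v -> exists B : {set T},
  [/\ v \in B, u \notin B &
    forall a b, a \notin B -> b \in B -> e a b -> a = u /\ b = v].
Proof.
move=> uv; pose e' := [rel a b | e a b && ~~ ((a == u) && (b == v) || (a == v) && (b == u))].
exists [set w | connect e' v w]; split; rewrite ?inE ?connect0 //.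
  apply/negP=> /connectP[p0 pp0]; case/shortenP: pp0 => p pp up _ lp.
  have pe : path e v p by apply: sub_path pp => a b /andP[].
  (* [acyclic] tolerates cycles of length at most 2, so two short cases remain: an empty [p] makes
     the edge a loop, and a single step is the deleted edge. *)
  have := e_acyc (c := v :: p); rewrite /ucycle /cycle rcons_path pe up -lp uv => /(_ isT).
  case: p lp pp {up pe} => [uv'|w [|//]] /=.
    by rewrite uv' e_irr in uv.
  by move=> ->; rewrite !eqxx orbT andbF.
move=> a b; rewrite !inE => na vb ab.
have: ~~ e' b a by apply: contra na => ba; apply: connect_trans vb _; exact: connect1.
rewrite /= e_sym ab /= negbK => /orP[] /andP[/eqP bE /eqP aE] //.
by rewrite aE connect0 in na.
Qed.

(* For an edge [u v], the component of [v] in the tree minus this edge. *)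
Definition branch u v : {set T} := [set w | d v w < d u w].

(** A walk into the component cut off by [u v] must use that edge, so distances across it add up;
    this additivity in turn identifies the component with [branch u v]. *)
Lemma branch_props u v : e u v ->
  (forall a b, a \notin branch u v -> b \in branch u v -> e a b -> a = u /\ b = v)
  /\ (forall a b, a \notin branch u v -> b \in branch u v -> d a b = d a u + 1 + d v b).
Proof.
move=> uv; have [B [vB uB cross]] := edge_cut uv.
have far a b : a \notin B -> b \in B -> d a b = d a u + 1 + d v b.
  move=> aB bB; apply/eqP; rewrite eqn_leq; apply/andP; split.
    have := tri u a b; have := tri v u b; have := dist_edge uv; lia.
  have [p [pp lp <-]] := dist_path e_conn a b.
  elim: p a aB pp lp => [|z p IH] a aB /=; first by move=> _ abE; rewrite abE bB in aB.
  case/andP=> az pp lp; case: (boolP (z \in B)) => zB.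
    have [-> zv] := cross _ _ aB zB az; rewrite d0 -zv.
    have := dist_le_path pp lp; lia.
  have := IH z zB pp lp; have := tri z a u; have := dist_edge az; lia.
suff -> : branch u v = B by [].
apply/setP=> w; rewrite inE; case: (boolP (w \in B)) => wB.
  by rewrite (far u w) // d0; lia.
by have := far w v wB vB; rewrite d0 (dC v) (dC u); lia.
Qed.

Lemma branch_cross u v a b : e u v ->
  a \notin branch u v -> b \in branch u v -> e a b -> a = u /\ b = v.
Proof. by case/branch_props => H _; exact: H. Qed.

Lemma branch_far u v a b : e u v ->
  a \notin branch u v -> b \in branch u v -> d a b = d a u + 1 + d v b.
Proof. by case/branch_props => _ H; exact: H. Qed.

Lemma branch_base u v : e u v -> v \in branch u v.
Proof.
move=> uv; rewrite inE d0 lt0n; apply: contraTneq uv => /(dist_eq0 e_conn) ->.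
by rewrite e_irr.
Qed.

Lemma branch_root u v : u \notin branch u v.
Proof. by rewrite inE d0. Qed.

Lemma branch_sym u v w : e u v -> (w \in branch v u) = (w \notin branch u v).
Proof.
move=> uv; case: (boolP (w \in branch u v)) => wB.
  by move: wB; rewrite !inE; lia.
have := branch_far uv wB (branch_base uv).
by rewrite inE d0 (dC v) (dC u); lia.
Qed.

Lemma branch_step x v : x != v -> exists2 z, e x z & v \in branch x z.
Proof.
have [[|z p] /= [pp lp sp]] := dist_path e_conn x v; first by rewrite lp eqxx.
case/andP: pp => xz pp _; exists z => //.
by rewrite inE -sp; have := dist_le_path pp lp; lia.
Qed.

Lemma branch_sib m x y : e m x -> e m y -> x != y -> y \notin branch m x.
Proof.
move=> mx my; apply: contra => yB.
by have [_ ->] := branch_cross mx (branch_root m x) yB my.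
Qed.

Lemma branch_disj m x y v : e m x -> e m y -> x != y ->
  v \in branch m x -> v \notin branch m y.
Proof.
move=> mx my xy vB; rewrite inE (branch_far mx (branch_root _ _) vB) d0.
rewrite (branch_far mx (branch_sib mx my xy) vB); lia.
Qed.

(** [branch m x] is the complement of [branch x m], which is disjoint from the sibling
    [branch x z]. *)
Lemma branch_sub m x z v : e m x -> e x z -> z != m ->
  v \in branch x z -> v \in branch m x.
Proof.
move=> mx xz zm vB; have xm : e x m by rewrite e_sym.
by rewrite (branch_sym _ xm); exact: branch_disj xz xm zm vB.
Qed.

(** Provides the decreasing measure for the inductions that descend into branches. *)
Lemma branch_proper m x z : e m x -> e x z -> z != m ->
  #|branch x z| < #|branch m x|.
Proof.
move=> mx xz zm; apply: proper_card; apply/properP; split.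
  by apply/subsetP=> v; exact: branch_sub.
by exists x; [exact: branch_base | exact: branch_root].
Qed.

Lemma branch_child m x v : e m x -> v \in branch m x -> v != x ->
  exists z, [/\ e x z, z != m & v \in branch x z].
Proof.
move=> mx vB; rewrite eq_sym => /branch_step[z xz vz]; exists z; split=> //.
apply: contraTneq vz => ->; rewrite branch_sym ?vB //.
Qed.

Lemma branch_leaf m x v : e m x -> leaf e x -> v \in branch m x -> v = x.
Proof.
move=> mx lx vB; apply/eqP; apply: contraT => /(branch_child mx vB)[z [xz /eqP[]]].
by apply: leaf_nb lx xz _; rewrite e_sym.
Qed.

Lemma branch_cover m v : v = m \/ exists2 x, e m x & v \in branch m x.
Proof. by have [|] := eqVneq m v; [left | right; exact: branch_step]. Qed.

(** * Resolving sets and forks *)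

Lemma bipartite x y s : e x y -> d s x != d s y.
Proof.
move=> xy; case: (boolP (s \in branch x y)); first by rewrite inE !(dC s); lia.
by rewrite -(branch_sym _ xy) inE !(dC s); lia.
Qed.

(* Each [s] in [S] is equidistant from [x] and [y], hence lies behind neither of
   them; so moving both one step towards each other keeps them unresolved, until
   they meet at [m]. *)
Lemma fork_of_unresolved (S : {set T}) x y : x != y ->
  (forall s, s \in S -> d s x = d s y) ->
  S = set0 \/ exists m a b, [/\ e m a, e m b, a != b,
    forall s, s \in S -> s \notin branch m a &
    forall s, s \in S -> s \notin branch m b].
Proof.
have [->|[s0 s0S]] := set_0Vmem S; first by left.
move=> xy unres; right.
have [n] := ubnP (d x y); elim: n => // n IH in x y xy unres *; move=> lt_n.
have [x1 xx1 yx1] := branch_step xy.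
have x1x : e x1 x by rewrite e_sym.
have [x1y|x1y] := eqVneq x1 y.
  by have := bipartite s0 xx1; rewrite x1y unres // eqxx.
have [y1 yy1 x1y1] : exists2 z, e y z & x1 \in branch y z.
  by apply: branch_step; rewrite eq_sym.
have y1y : e y1 y by rewrite e_sym.
have xy1 : x \in branch y y1.
  apply: contraT => nx; have [/eqP] := branch_cross yy1 nx x1y1 xx1.
  by rewrite (negPf xy).
have ynB : y \notin branch x1 x by rewrite -(branch_sym _ x1x).
have xnB : x \notin branch y1 y by rewrite -(branch_sym _ y1y).
have Sx s : s \in S -> s \notin branch x1 x.
  move=> sS; apply/negP=> sB; have := unres s sS; rewrite -(dC y) -(dC x).
  by rewrite (branch_far x1x ynB sB); clear; lia.
have Sy s : s \in S -> s \notin branch y1 y.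
  move=> sS; apply/negP=> sB; have := unres s sS; rewrite -(dC y) -(dC x).
  by rewrite (branch_far y1y xnB sB); clear; lia.
have [x1E|nx1y1] := eqVneq x1 y1; first by exists x1, x, y; rewrite x1E in Sx x1x *.
apply: IH nx1y1 _ _ => [s sS|].
  have := unres s sS; rewrite (branch_far x1x (Sx s sS) (branch_base x1x)).
  by rewrite (branch_far y1y (Sy s sS) (branch_base y1y)) !d0; clear; lia.
have x1nB : x1 \notin branch y1 y by rewrite -(branch_sym _ y1y).
have := branch_far x1x ynB (branch_base x1x).
have := branch_far y1y x1nB (branch_base y1y).
by rewrite !d0 (dC y x) (dC y x1); move: lt_n; clear; lia.
Qed.

Lemma resolvingP (S : {set T}) :
  reflect (forall x y, x != y -> exists2 s, s \in S & d s x != d s y) (resolving e S).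
Proof.
apply: (iffP forallP) => H x.
  move=> y xy; have /implyP/(_ xy)/existsP[s /andP[sS sxy]] := forallP (H x) y.
  by exists s.
apply/forallP=> y; apply/implyP=> /H[s sS sxy].
by apply/existsP; exists s; rewrite sS.
Qed.

(** A vertex outside both branches reaches [a] and [b] only through [m], hence at equal
    distances. *)
Lemma resolving_fork (S : {set T}) m a b : resolving e S ->
  e m a -> e m b -> a != b ->
  exists2 s, s \in S & (s \in branch m a) || (s \in branch m b).
Proof.
move=> /resolvingP R ma mb ab; have [s sS sab] := R a b ab.
exists s => //; apply: contraR sab; rewrite negb_or => /andP[sa sb].
by rewrite (branch_far ma sa (branch_base ma)) (branch_far mb sb (branch_base mb)) !d0.
Qed.

(** Nonemptiness matters for the one-edge tree, which has no fork although the empty set does not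
    resolve it. *)
Lemma fork_resolving (S : {set T}) : S != set0 ->
  (forall m a b, e m a -> e m b -> a != b ->
     exists2 s, s \in S & (s \in branch m a) || (s \in branch m b)) ->
  resolving e S.
Proof.
move=> /negPf S0 H; apply/resolvingP=> x y xy; apply/exists_inP; apply: contraT.
rewrite negb_exists_in => /forall_inP unres.
have [|/eqP|[m [a [b [ma mb ab Sa Sb]]]]] := fork_of_unresolved xy (S := S).
- by move=> s /unres; rewrite negbK => /eqP.
- by rewrite S0.
have [s sS] := H m a b ma mb ab.
by rewrite (negPf (Sa s sS)) (negPf (Sb s sS)).
Qed.

(** * Branches without major vertices *)

(** The adjacency clause of [is_path_graph], isolated so that it can be carried through the
    induction along a branch. *)
Definition consecutive (s : seq T) v w :=
  exists s1 s2, s = s1 ++ v :: w :: s2 \/ s = s1 ++ w :: v :: s2.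

Lemma consecutiveC s v w : consecutive s v w -> consecutive s w v.
Proof. by move=> [s1 [s2 H]]; exists s1, s2; case: H; [right|left]. Qed.

Lemma consecutive_cons s x v w : consecutive s v w -> consecutive (x :: s) v w.
Proof.
by move=> [s1 [s2 H]]; exists (x :: s1), s2; case: H => ->; [left|right].
Qed.

Lemma nonleaf_child m x : e m x -> ~~ leaf e x -> exists2 z, e x z & z != m.
Proof.
rewrite e_sym => xm nlx; apply/exists_inP; apply: contraR nlx.
rewrite negb_exists_in => /forall_inP H; apply: leaf_intro xm _ => z /H.
by rewrite negbK => /eqP.
Qed.

(** Here [x] has degree 2, so beyond [x] the branch continues in a single direction. *)
Lemma nonmajor_child m x : e m x -> ~~ major e x -> ~~ leaf e x ->
  exists z, [/\ e x z, z != m &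
    forall w, (w \in branch m x) = (w == x) || (w \in branch x z)].
Proof.
move=> mx nMx /(nonleaf_child mx)[z xz zm]; exists z; split=> // w.
apply/idP/orP=> [wB|[/eqP->|]]; [|exact: branch_base|exact: branch_sub].
have [->|wx] := eqVneq w x; [by left | right].
have [z' [xz' z'm wz']] := branch_child mx wB wx.
suff <- : z' = z by [].
have xm : e x m by rewrite e_sym.
have mz : m != z by rewrite eq_sym.
have [zm'|//] := nonmajor_nb nMx xm xz mz xz'.
by rewrite zm' eqxx in z'm.
Qed.

(** Such a branch descends through vertices of degree 2 to a leaf. The list includes [m] so that the
    induction can prepend one vertex at a time. *)
Lemma majorless_branch m x : e m x ->
  (forall w, w \in branch m x -> ~~ major e w) ->
  exists p, [/\ path e m (x :: p), uniq (m :: x :: p),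
    forall w, (w \in x :: p) = (w \in branch m x), leaf e (last x p) &
    forall v w, v \in m :: x :: p -> w \in m :: x :: p -> e v w ->
      consecutive (m :: x :: p) v w].
Proof.
have [n] := ubnP #|branch m x|; elim: n => // n IH in m x *; move=> lt_n mx nM.
have xm : e x m by rewrite e_sym.
have [lx|nlx] := boolP (leaf e x).
  have xB w : (w \in [:: x]) = (w \in branch m x).
    by rewrite inE; apply/eqP/idP=> [->|/(branch_leaf mx lx)//]; exact: branch_base.
  exists [::]; split; rewrite /= ?mx ?inE ?andbT ?(edge_neq mx) //.
  move=> v w; rewrite !inE => /orP[]/eqP-> /orP[]/eqP->; rewrite ?e_irr // => _.
    by exists [::], [::]; left.
  by exists [::], [::]; right.
have [z [xz zm xB]] := nonmajor_child mx (nM x (branch_base mx)) nlx.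
have [p [pp up pB lp cons]] : exists p, [/\ path e x (z :: p), uniq (x :: z :: p),
    forall w, (w \in z :: p) = (w \in branch x z), leaf e (last z p) &
    forall v w, v \in x :: z :: p -> w \in x :: z :: p -> e v w ->
      consecutive (x :: z :: p) v w].
  apply: IH => //; first by have := branch_proper mx xz zm; lia.
  by move=> w wB; apply: nM; exact: branch_sub wB.
have xzB w : (w \in x :: z :: p) = (w \in branch m x). by rewrite in_cons pB xB.
exists (z :: p); split=> //.
- by rewrite [path _ _ _]/= mx.
- by rewrite cons_uniq up xzB branch_root.
have nbm w : w \in x :: z :: p -> e m w -> w = x.
  by rewrite xzB => wB /(branch_cross mx (branch_root m x) wB)[].
have consm : consecutive (m :: x :: z :: p) m x by exists [::], (z :: p); left.
move=> v w; rewrite in_cons (in_cons m _ w) => /predU1P[->|vP] /predU1P[->|wP].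
- by rewrite e_irr.
- by move=> /(nbm _ wP)->.
- by rewrite e_sym => /(nbm _ vP)->; exact: consecutiveC.
by move=> /(cons _ _ vP wP); exact: consecutive_cons.
Qed.

(** Descending from any vertex ends at a leaf [m]; the only branch at [m] contains all other
    vertices, so its listing, preceded by [m], exhausts the tree. *)
Lemma majorless_tree_path : 1 < #|T| -> (forall x, ~~ major e x) -> is_path_graph e.
Proof.
move=> T1 nM; have /card_gt1P[r [r' [_ _ rr']]] := T1.
have [z rz _] := branch_step rr'.
have [p [pp _ _ lp _]] := majorless_branch rz (fun w _ => nM w).
set m := last z p in lp; have [x mx] := leaf_nb_ex lp.
have [q [pq uq qB _ cons]] := majorless_branch mx (fun w _ => nM w).
have all_in w : w \in m :: x :: q.
  rewrite in_cons qB; have [->|[y my wy]] := branch_cover m w; first by rewrite eqxx.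
  by rewrite (leaf_nb lp mx my) wy orbT.
exists (m :: x :: q); split=> // v w; split; first exact: cons.
have consE s1 s2 a b : m :: x :: q = s1 ++ a :: b :: s2 -> e a b.
  case: s1 => [|c s1] /= [mE E]; first by move: pq; rewrite E mE /= => /andP[].
  by move: pq; rewrite E cat_path /= => /andP[_ /and3P[]].
by move=> [s1 [s2 [/consE|/consE]]] //; rewrite e_sym.
Qed.

(** * Strong support vertices and all but one of their leaves *)

Hypothesis has_major : exists r, major e r.

(** Otherwise all neighbours of [w] are leaves and the tree is a path on three vertices, without any
    major vertex. *)
Lemma strong_support_major w : strong_support e w -> major e w.
Proof.
case/strong_supportP=> a [b [wa wb la lb ab]]; apply: contraT => nMw.
have [r Mr] := has_major.
have [rw|[c wc rc]] := branch_cover w r; first by rewrite -rw Mr in nMw.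
have lc : leaf e c by have [->|->] := nonmajor_nb nMw wa wb ab wc.
by rewrite (branch_leaf wc lc rc) (negPf (leaf_not_major lc)) in Mr.
Qed.

Definition strong_leaves : {set T} :=
  [set y | leaf e y & [exists x, e x y && strong_support e x]].

Lemma strong_leavesP y :
  reflect (leaf e y /\ exists2 w, e w y & strong_support e w) (y \in strong_leaves).
Proof. by rewrite inE; apply: (iffP andP) => -[ly /exists_inP]. Qed.

(** The leaf at [w] to be left out of [selected]; the default [w] occurs only if [w] has no leaf
    neighbour. *)
Definition some_leaf w := odflt w [pick y | e w y && leaf e y].

Lemma some_leafP w : strong_support e w -> e w (some_leaf w) /\ leaf e (some_leaf w).
Proof.
case/strong_supportP=> a [b [wa _ la _ _]]; rewrite /some_leaf.
by case: pickP => [y /andP[]//|/(_ a)]; rewrite wa la.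
Qed.

Lemma some_leaf_inj : {in strong_supports e &, injective some_leaf}.
Proof.
move=> w w'; rewrite !inE => /some_leafP[wy ly] /some_leafP[+ _] E.
by rewrite -E e_sym => yw'; apply: leaf_nb ly _ yw'; rewrite e_sym.
Qed.

Lemma some_leaf_sub : some_leaf @: strong_supports e \subset strong_leaves.
Proof.
apply/subsetP=> y /imsetP[w]; rewrite inE => sw ->.
by have [wy ly] := some_leafP sw; apply/strong_leavesP; split=> //; exists w.
Qed.

Lemma strong_supports_le : #|strong_supports e| <= ell' e.
Proof. by rewrite -(card_in_imset some_leaf_inj) subset_leq_card ?some_leaf_sub. Qed.

(** This set completes any dominating set to a resolving one, and under (iv) it is itself a minimum
    resolving set. *)
Definition selected : {set T} := strong_leaves :\: some_leaf @: strong_supports e.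

Lemma card_selected : #|selected| = ell' e - #|strong_supports e|.
Proof. by rewrite cardsDS ?some_leaf_sub // (card_in_imset some_leaf_inj). Qed.

Lemma selected_twins w a b : e w a -> e w b -> leaf e a -> leaf e b -> a != b ->
  (a \in selected) || (b \in selected).
Proof.
move=> wa wb la lb ab; apply: contraT; rewrite negb_or => /andP[na nb].
have sw : strong_support e w by apply/strong_supportP; exists a, b.
(* A leaf can be left out only as the one picked at its own neighbour, which is [w]. *)
have nsel c : e w c -> leaf e c -> c \notin selected -> c = some_leaf w.
  move=> wc lc; rewrite inE negb_and negbK => /orP[/imsetP[w' + cE]|/negP[]].
    rewrite inE => /some_leafP[]; rewrite -cE => w'c _.
    by rewrite cE; congr some_leaf; apply: leaf_nb lc _ _; rewrite e_sym.
  by apply/strong_leavesP; split=> //; exists w.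
by case/eqP: ab; rewrite (nsel a) // (nsel b).
Qed.

Lemma selected_fork_leaves m a b : e m a -> e m b -> leaf e a -> leaf e b ->
  a != b -> exists2 s, s \in selected & (s \in branch m a) || (s \in branch m b).
Proof.
move=> ma mb la lb ab.
have /orP[sa|sb] := selected_twins ma mb la lb ab.
  by exists a; rewrite ?branch_base.
by exists b; rewrite ?branch_base ?orbT.
Qed.

(** * Domination and the upper bound for the MLD-number *)

Lemma dominatingP (D : {set T}) :
  reflect (forall v, v \notin D -> exists2 u, u \in D & e v u) (dominating e D).
Proof.
by apply: (iffP forallP) => H v; [move=> /(implyP (H v))/exists_inP|
  apply/implyP=> /H/exists_inP].
Qed.

(** Only [a] can be dominated from outside the branch, by [m]; a further neighbour [z] of [a] has
    all its neighbours inside, where [D] has no vertex. *)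
Lemma undominated_branch_leaf (D : {set T}) m a : dominating e D -> e m a ->
  (forall s, s \in D -> s \notin branch m a) -> leaf e a.
Proof.
move=> /dominatingP domD ma Da; apply: contraT => /(nonleaf_child ma)[z az zm].
have zB : z \in branch m a := branch_sub ma az zm (branch_base az).
have [|u uD] := domD z; first by apply: contraL zB; exact: Da.
rewrite e_sym => uz; have [_ zE] := branch_cross ma (Da u uD) zB uz.
by rewrite zE e_irr in az.
Qed.

(* If [D :|: selected] avoids both branches of a fork, domination forces both
   branches to be single leaves, and [selected] contains one of two twin leaves. *)
Lemma dominating_selected_resolving (D : {set T}) :
  dominating e D -> resolving e (D :|: selected).
Proof.
move=> domD; apply: fork_resolving => [|m a b ma mb ab].
  have [r _] := has_major; have /dominatingP/(_ r) := domD.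
  apply: contraPneq => /eqP; rewrite setU_eq0 => /andP[/eqP-> _].
  by rewrite in_set0 => /(_ isT)[u]; rewrite in_set0.
apply/exists_inP; apply: contraT; rewrite negb_exists_in => /forall_inP H.
have HD s : s \in D -> (s \notin branch m a) /\ (s \notin branch m b).
  by move=> sD; have := H s; rewrite inE sD negb_or => /(_ isT)/andP[].
have la := undominated_branch_leaf domD ma (fun s sD => proj1 (HD s sD)).
have lb := undominated_branch_leaf domD mb (fun s sD => proj2 (HD s sD)).
have [s sS sB] := selected_fork_leaves ma mb la lb ab.
by have := H s; rewrite inE sS orbT sB => /(_ isT).
Qed.

Lemma mld_number_le :
  mld_number e <= domination_number e + (ell' e - #|strong_supports e|).
Proof.
have [D domD cD] := min_cardP (dominating_setT e).
rewrite /domination_number -cD -card_selected; apply: leq_trans (leq_card_setU D selected).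
apply: min_card_le; rewrite dominating_selected_resolving //=.
apply/dominatingP=> v; rewrite inE negb_or => /andP[vD _].
by have [u uD vu] := dominatingP _ domD v vD; exists u; rewrite ?inE ?uD.
Qed.

(** * Lower bounds for the metric dimension and the MLD-number *)

Definition nb x := odflt x [pick y | e x y].

Lemma nbP x y : leaf e x -> e x y -> nb x = y.
Proof.
move=> lx xy; rewrite /nb; case: pickP => [z xz|/(_ y)]; last by rewrite xy.
exact: leaf_nb lx xz xy.
Qed.

(** Two leaves at the same vertex form a fork of one-vertex branches, so [S] contains one of
    them. *)
Lemma nb_inj (S : {set T}) : resolving e S ->
  {in strong_leaves :\: S &, injective nb}.
Proof.
move=> resS x y /setDP[/strong_leavesP[lx [w wx _]] xS].
move=> /setDP[/strong_leavesP[ly [w' wy _]] yS].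
rewrite (nbP lx (y := w)) 1?e_sym // (nbP ly (y := w')) 1?e_sym // => ww'; subst w'.
apply/eqP; apply: contraT => xy.
have [s sS /orP[/(branch_leaf wx lx)|/(branch_leaf wy ly)] sE] := resolving_fork resS wx wy xy.
  by rewrite -sE sS in xS.
by rewrite -sE sS in yS.
Qed.

Lemma nb_sub (S : {set T}) : nb @: (strong_leaves :\: S) \subset strong_supports e.
Proof.
apply/subsetP=> w /imsetP[x /setDP[/strong_leavesP[lx [w' wx sw]] _] ->].
by rewrite (nbP lx (y := w')) 1?e_sym // inE.
Qed.

Lemma card_missing_leaves (S : {set T}) : resolving e S ->
  #|strong_leaves :\: S| <= #|strong_supports e|.
Proof.
by move=> resS; rewrite -(card_in_imset (nb_inj resS)) subset_leq_card ?nb_sub.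
Qed.

Lemma metric_dim_ge : ell' e - #|strong_supports e| <= metric_dim e.
Proof.
have [S resS cS] := min_cardP (resolving_setT e_conn).
rewrite /metric_dim -cS.
have := cardsID S strong_leaves; rewrite -[#|strong_leaves|]/(ell' e).
have := card_missing_leaves resS; have := subset_leq_card (subsetIr strong_leaves S).
by clear; lia.
Qed.

(* An MLD-set missing a leaf at a strong support vertex contains that vertex and
   all its other leaves, so trading the leaves for the vertex saves enough. *)
Lemma mld_number_ge :
  domination_number e + (ell' e - #|strong_supports e|) <= mld_number e.
Proof.
have [|S /andP[resS domS] cS] := @min_cardP _ (fun S => resolving e S && dominating e S) setT.
  by rewrite resolving_setT ?dominating_setT.
rewrite /mld_number -cS; pose D := (S :\: strong_leaves) :|: strong_supports e.
have domD : dominating e D.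
  apply/dominatingP=> v; rewrite !(in_setU, in_setD) negb_or negb_and negbK => /andP[vS vss].
  have [/strong_leavesP[lv [w wv sw]]|vL] := boolP (v \in strong_leaves).
    by exists w; rewrite ?inE ?sw ?orbT // e_sym.
  rewrite (negPf vL) /= in vS.
  have [s sS vs] := dominatingP _ domS v vS; exists s => //.
  rewrite in_setU in_setD sS andbT; apply/orP; left.
  (* If [s] were a strong leaf, its only neighbour [v] would be a strong support vertex, already in
     [D]. *)
  apply: contra vss => /strong_leavesP[ls [w ws sw]].
  by rewrite inE (@leaf_nb _ e s v w) // e_sym.
(* A missing leaf is dominated by its only neighbour, so here the strong support vertices with a
   missing leaf lie in [S]. *)
have missS : #|strong_leaves :\: S| <= #|S :&: strong_supports e|.
  rewrite -(card_in_imset (nb_inj resS)); apply: subset_leq_card.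
  rewrite subsetI nb_sub andbT; apply/subsetP=> w /imsetP[x].
  move=> /setDP[/strong_leavesP[lx _] xS] ->.
  by have [u uS xu] := dominatingP _ domS x xS; rewrite (nbP lx xu).
have leD : domination_number e <= #|D| := min_card_le domD.
(* Strong support vertices in [S] are major, so they survive the removal of leaves; only those
   outside [S] count as added. *)
have cD : #|D| <= #|S :\: strong_leaves| + #|strong_supports e :\: S|.
  apply: leq_trans (leq_card_setU _ _); apply: subset_leq_card.
  apply/subsetP=> v; rewrite !(in_setU, in_setD) => /orP[->//|sv].
  rewrite sv andbT; case: (v \in S); rewrite ?orbT //= andbT orbF.
  apply/negP=> /strong_leavesP[/leaf_not_major].
  by rewrite strong_support_major //; rewrite inE in sv.
have := cardsID strong_leaves S; have := cardsID S strong_leaves.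
have := cardsID S (strong_supports e); rewrite -[#|strong_leaves|]/(ell' e).
rewrite (setIC (strong_supports e)) (setIC strong_leaves).
move: missS leD cD (strong_supports_le); clear; lia.
Qed.

(** * Terminal vertices and the step from (ii) to (iii) *)

(** Equality in the count behind [metric_dim_ge] leaves no room for other vertices in [S], nor for a
    strong support vertex without a missing leaf. *)
Lemma min_resolving_leaves (S : {set T}) : resolving e S ->
  #|S| = ell' e - #|strong_supports e| ->
  S \subset strong_leaves /\ nb @: (strong_leaves :\: S) = strong_supports e.
Proof.
move=> resS cS; have miss := card_missing_leaves resS.
have cI := cardsID S strong_leaves; rewrite -[#|strong_leaves|]/(ell' e) in cI.
have le_l := strong_supports_le.
have sI := subset_leq_card (subsetIr strong_leaves S).
split.
  apply/setIidPr/eqP; rewrite eqEcard subsetIr /=; move: miss cI cS; clear; lia.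
apply/eqP; rewrite eqEcard nb_sub (card_in_imset (nb_inj resS)) /=.
by move: cI cS le_l sI; clear; lia.
Qed.

(** Descending from [u] through vertices of degree 2, the first major vertex met separates the leaf
    [x] from [u]. *)
Lemma closer_major u z x : e u z -> leaf e x -> x \in branch u z ->
  (exists2 w, w \in branch u z & major e w) ->
  exists2 w, major e w & d x w < d x u.
Proof.
have [n] := ubnP #|branch u z|; elim: n => // n IH in u z *.
move=> lt_n uz lx xB [w wB Mw].
have [Mz|nMz] := boolP (major e z).
  by exists z => //; move: xB; rewrite inE !(dC x).
have [lz|nlz] := boolP (leaf e z).
  by rewrite -(branch_leaf uz lz wB) Mw in nMz.
have [z' [zz' z'u uzB]] := nonmajor_child uz nMz nlz.
move: wB xB; rewrite !uzB => /predU1P[wz|wB]; first by rewrite -wz Mw in nMz.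
case/predU1P=> [xz|xB]; first by rewrite -xz lx in nlz.
have lt' : #|branch z z'| < n.
  by have := branch_proper uz zz' z'u; move: lt_n; clear; lia.
have [|w' Mw' lt] := IH z z' lt' zz' lx xB; first by exists w.
exists w' => //; apply: ltn_trans lt _.
by have := branch_sub uz zz' z'u xB; rewrite inE !(dC x).
Qed.

Lemma terminal_branch u x : terminal e u x -> exists z, [/\ e u z,
  x \in branch u z & forall w, w \in branch u z -> ~~ major e w].
Proof.
case/and3P=> lx Mu /forallP close.
have [xu|[z uz xB]] := branch_cover u x.
  by rewrite -xu (negPf (leaf_not_major lx)) in Mu.
exists z; split=> // w wB; apply/negP=> Mw.
have [|w' Mw'] := closer_major uz lx xB; first by exists w.
by have := close w'; rewrite Mw' /= leqNgt => /negPf->.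
Qed.

Lemma branch_terminal u z x : e u z -> major e u -> leaf e x -> x \in branch u z ->
  (forall w, w \in branch u z -> ~~ major e w) -> terminal e u x.
Proof.
move=> uz Mu lx xB nM; rewrite /terminal lx Mu; apply/forallP=> w; apply/implyP=> Mw.
have wB : w \notin branch u z by apply: contraL Mw; exact: nM.
rewrite !(dC x) (branch_far uz wB xB) (branch_far uz (branch_root u z) xB) d0.
by clear; lia.
Qed.

(** Ensures that distinct terminal vertices of [u] lie in different branches at [u]. *)
Lemma majorless_branch_leaf u z x y : e u z ->
  (forall w, w \in branch u z -> ~~ major e w) ->
  leaf e x -> leaf e y -> x \in branch u z -> y \in branch u z -> x = y.
Proof.
have [n] := ubnP #|branch u z|; elim: n => // n IH in u z *.
move=> lt_n uz nM lx ly.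
have [lz|nlz] := boolP (leaf e z).
  by move=> /(branch_leaf uz lz)-> /(branch_leaf uz lz)->.
have [z' [zz' z'u uzB]] := nonmajor_child uz (nM z (branch_base uz)) nlz.
rewrite !uzB => /predU1P[xz|xB]; first by rewrite -xz lx in nlz.
move=> /predU1P[yz|yB]; first by rewrite -yz ly in nlz.
apply: (IH z z') => //; last by move=> w wB; apply: nM; rewrite uzB wB orbT.
by have := branch_proper uz zz' z'u; move: lt_n; clear; lia.
Qed.

(** The support vertex of [s] is major, hence outside the branch, and [u z] is the only edge leaving
    the branch. *)
Lemma strong_leaf_in_majorless (S : {set T}) u z s : S \subset strong_leaves ->
  e u z -> (forall w, w \in branch u z -> ~~ major e w) ->
  s \in S -> s \in branch u z -> s = z /\ strong_support e u.
Proof.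
move=> SL uz nM /(subsetP SL)/strong_leavesP[_ [w ws sw]] sB.
have wB : w \notin branch u z.
  by apply: contraL (strong_support_major sw); exact: nM.
by have [<- ->] := branch_cross uz wB sB ws.
Qed.

(* A minimum resolving set consists of all but one of the leaves at each strong
   support vertex, so it misses the whole leg of a non-adjacent terminal vertex
   together with the leg of some other terminal vertex. *)
Lemma terminals_adjacent : metric_dim e = ell' e - #|strong_supports e| ->
  forall u x, exterior_major e u -> 2 <= ter e u -> terminal e u x -> e u x.
Proof.
have [S resS cS] := min_cardP (resolving_setT e_conn).
rewrite /metric_dim -cS; case/(min_resolving_leaves resS)=> SL nbS u x _ ter2 tx.
apply: contraT => nux.
have [z [uz xB nM]] := terminal_branch tx; have /and3P[lx Mu _] := tx.
have nlz : ~~ leaf e z.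
  by apply: contra nux => /(branch_leaf uz)/(_ xB)->.
have Sz s : s \in S -> s \notin branch u z.
  move=> sS; apply/negP=> sB.
  have [sz _] := strong_leaf_in_majorless SL uz nM sS sB.
  have /strong_leavesP[ls _] := subsetP SL s sS.
  by rewrite -sz ls in nlz.
(* The second avoided branch is the missing leaf if [u] is a strong support vertex, and otherwise
   the leg of another terminal vertex. *)
have [y [uy zy Sy]] : exists y, [/\ e u y, z != y &
    forall s, s \in S -> s \notin branch u y].
  have [su|nsu] := boolP (strong_support e u).
    have: u \in nb @: (strong_leaves :\: S) by rewrite nbS inE.
    case/imsetP=> y /setDP[/strong_leavesP[ly [w wy _]] yS] uE.
    have uy : e u y by rewrite uE (nbP ly (y := w)) // e_sym.
    exists y; split=> //; first by apply: contraNneq nlz => ->.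
    by move=> s sS; apply: contraNN yS => /(branch_leaf uy ly)<-.
  have [y ty yx] : exists2 y, terminal e u y & y != x.
    move: ter2; rewrite /ter (cardsD1 x) inE tx => /card_gt0P[y].
    by rewrite !inE => /andP[yx ty]; exists y.
  have [y' [uy' yB nM']] := terminal_branch ty; have /and3P[ly _ _] := ty.
  exists y'; split=> //.
    apply: contraNneq yx => zE; rewrite -zE in yB.
    by apply/eqP; apply: majorless_branch_leaf nM ly lx yB xB.
  move=> s sS; apply/negP=> /(strong_leaf_in_majorless SL uy' nM' sS)[_].
  exact/negP.
have [s sS] := resolving_fork resS uz uy zy.
by rewrite (negPf (Sz s sS)) (negPf (Sy s sS)).
Qed.

(** * From (iii) to (iv) *)

(** No vertex after [m] offers a way off the path, so the path exhausts the branch. *)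
Lemma majorless_path_branch m z q : path e m (z :: q) -> uniq (m :: z :: q) ->
  leaf e (last z q) -> (forall w, w \in z :: q -> ~~ major e w) ->
  (forall w, w \in branch m z -> ~~ major e w) /\ last z q \in branch m z.
Proof.
elim: q m z => [|z2 q IH] m z /= /andP[mz pq] uq lq nM.
  split=> [w /(branch_leaf mz lq)->|]; last exact: branch_base.
  exact: leaf_not_major.
have /andP[zz2 _] := pq.
have z2m : z2 != m by apply: contraTneq uq => ->; rewrite !inE eqxx orbT.
have nMz : ~~ major e z by apply: nM; rewrite inE eqxx.
have nlz : ~~ leaf e z.
  apply/negP=> lz; case/eqP: z2m; apply: leaf_nb lz zz2 _; by rewrite e_sym.
have [z' [zz' z'm mzB]] := nonmajor_child mz nMz nlz.
have z'E : z2 = z'.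
  have := branch_sub mz zz2 z2m (branch_base zz2); rewrite mzB.
  case/predU1P=> [zE|]; first by rewrite zE e_irr in zz2.
  by move=> z2B; apply: esym; apply/eqP; apply: contraLR z2B; exact: branch_sib.
subst z'; have uq' : uniq (z :: z2 :: q) by case/andP: uq.
have [|nMB lB] := IH z z2 pq uq' lq.
  by move=> w wq; apply: nM; rewrite in_cons wq orbT.
split; last by rewrite mzB lB orbT.
by move=> w; rewrite mzB => /predU1P[->//|]; exact: nMB.
Qed.

(** If [u] is the only major vertex on the path, both halves are legs at [u]; the ends are then
    terminal vertices of [u], adjacent to it by (iii), and at distance at most 2. *)
Lemma leaf_paths_two_majors :
  (forall u x, exterior_major e u -> 2 <= ter e u -> terminal e u x -> e u x) ->
  forall (x y : T) (p : seq T), leaf e x -> leaf e y -> 2 < d x y ->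
    path e x p -> last x p = y -> uniq (x :: p) ->
    2 <= #|[set v in x :: p | major e v]|.
Proof.
move=> adj x y p lx ly dxy pp lp up; rewrite leqNgt; apply/negP => lt2.
(* A path without major vertices would exhaust the only branch at the leaf [x], leaving no place for
   a major vertex. *)
have [u uP Mu] : exists2 u, u \in x :: p & major e u.
  apply/exists_inP; apply: contraT; rewrite negb_exists_in => /forall_inP nM.
  case: p => [|z q] in pp lp up lt2 nM *.
    by rewrite -lp d0 in dxy.
  have [|w wq|nMB _] := majorless_path_branch pp up; first by move: ly; rewrite -lp.
    by apply: nM; rewrite in_cons wq orbT.
  have [r Mr] := has_major; have [rx|[z' xz' rB]] := branch_cover x r.
    by have := leaf_not_major lx; rewrite -rx Mr.
  have xz : e x z by case/andP: pp.
  by rewrite -(leaf_nb lx xz xz') in rB; rewrite (negPf (nMB r rB)) in Mr.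
have uniqM w : w \in x :: p -> w != u -> ~~ major e w.
  move=> wP wu; apply/negP=> Mw; move: lt2; rewrite ltnNge => /negP; apply.
  by apply/card_gt1P; exists w, u; split=> //; rewrite in_set ?wP ?uP.
have leg q z : path e u q -> leaf e z -> last u q = z -> uniq (u :: q) ->
    {subset q <= x :: p} -> terminal e u z.
  case: q => [|c q] pq lz lq uq sub.
    by move: lz; rewrite -lq /= => /leaf_not_major; rewrite Mu.
  have uc : e u c by case/andP: pq.
  have [||nM zB] := majorless_path_branch pq uq.
  - by move: lz; rewrite -lq.
  - move=> w wq; apply: uniqM; first exact: sub.
    by apply: contraTneq uq => <-; rewrite cons_uniq wq.
  rewrite /= in lq; rewrite lq in zB.
  exact: branch_terminal uc Mu lz zB nM.
have [p1 [p2 [pE lp1]]] : exists p1 p2, p = p1 ++ p2 /\ last x p1 = u.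
  by case/splitPl: uP => p1 p2 lp1; exists p1, p2.
move: pp lp; rewrite pE cat_path last_cat lp1 => /andP[pp1 pp2] lp2.
have up' : uniq ((x :: p1) ++ p2) by rewrite /= -pE.
have xp1E : x :: p1 = rcons (belast x p1) u by rewrite lastI lp1.
have [_ dis up2] : [/\ uniq (x :: p1), ~~ has (mem (x :: p1)) p2 & uniq p2].
  by apply/and3P; rewrite -cat_uniq.
have uu1 : uniq (u :: rev (belast x p1)).
  rewrite -rev_rcons -xp1E rev_uniq; by move: up'; rewrite cat_uniq => /and3P[].
have up1 : u \in x :: p1 by rewrite -lp1 mem_last.
have uu2 : uniq (u :: p2).
  rewrite cons_uniq up2 andbT; apply: contra dis => up2'.
  by apply/hasP; exists u.
have tx : terminal e u x.
  apply: (leg (rev (belast x p1))) => //.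
  - by rewrite -lp1; exact: path_rev.
  - by rewrite -lp1 last_rev_belast.
  by move=> w; rewrite mem_rev => /mem_belast wp; rewrite pE -cat_cons mem_cat wp.
have ty : terminal e u y.
  by apply: (leg p2) => //; move=> w w2; rewrite pE in_cons mem_cat w2 !orbT.
have xy : x != y by apply: contraTneq dxy => ->; rewrite d0.
have ter2 : 2 <= ter e u by apply/card_gt1P; exists x, y; rewrite !inE.
have eM : exterior_major e u by rewrite /exterior_major Mu ltnW.
have xu : e x u by rewrite e_sym; apply: adj tx.
move: dxy; rewrite ltnNge => /negP; apply; apply: leq_trans (tri u x y) _.
by rewrite (leq_add (dist_edge xu) (dist_edge (adj u y eM ter2 ty))).
Qed.

(** * From (iv) to the upper bound for the metric dimension *)

Section TwoMajors.
Hypothesis two_majors : forall (x y : T) (p : seq T), leaf e x -> leaf e y ->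
  2 < d x y -> path e x p -> last x p = y -> uniq (x :: p) ->
  2 <= #|[set v in x :: p | major e v]|.

(** Joining the two legs at [m] gives a path between leaves on which only [m] can be major, so by
    (iv) its ends are at distance at most 2. *)
Lemma majorless_fork_leaves m a b : e m a -> e m b -> a != b ->
  (forall w, w \in branch m a -> ~~ major e w) ->
  (forall w, w \in branch m b -> ~~ major e w) -> leaf e a /\ leaf e b.
Proof.
move=> ma mb ab nMa nMb.
have [p [pp up pB lp _]] := majorless_branch ma nMa.
have [q [pq uq qB lq _]] := majorless_branch mb nMb.
set x := last a p in lp; set y := last b q in lq.
have xB : x \in branch m a by rewrite -pB mem_last.
have yB : y \in branch m b by rewrite -qB mem_last.
have dxy : d x y = d a x + d b y + 2.
  rewrite (branch_far mb (branch_disj ma mb ab xB) yB) (dC x).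
  by rewrite (branch_far ma (branch_root _ _) xB) d0; clear; lia.
(* From [x], itself not listed, up the first leg to [m] and then down the second. *)
pose P := rev (belast m (a :: p)) ++ b :: q.
have xP : x :: P = rev (m :: a :: p) ++ b :: q.
  by rewrite [m :: _]lastI rev_rcons.
have pP : path e x P.
  by rewrite cat_path (path_rev e_sym pp) -/x (last_rev_belast m (a :: p)).
have lP : last x P = y by rewrite last_cat.
have uP : uniq (x :: P).
  move: uq; rewrite xP cat_uniq rev_uniq up cons_uniq => /andP[mq ->].
  rewrite andbT; apply/hasPn=> w wq; rewrite /= mem_rev in_cons negb_or pB.
  apply/andP; split; first by apply: contraTneq wq => ->.
  by apply: contraL wq => /(branch_disj ma mb ab); rewrite qB.
have small : #|[set v in x :: P | major e v]| <= 1.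
  rewrite -(cards1 m); apply: subset_leq_card; apply/subsetP=> v.
  rewrite inE xP mem_cat mem_rev (in_cons m) pB qB inE => /andP[/orP[/orP[//|]|]].
    by move/nMa/negPf->.
  by move/nMb/negPf->.
have : d x y <= 2.
  rewrite leqNgt; apply/negP => gt2.
  by move: small; rewrite leqNgt (two_majors lp lq gt2 pP lP uP).
rewrite dxy -[X in _ <= X]add0n leq_add2r leqn0 addn_eq0 => /andP[/eqP d1 /eqP d2].
by rewrite (dist_eq0 e_conn d1) (dist_eq0 e_conn d2).
Qed.

(** At a deepest major vertex, two branches pointing away from [m] have no major vertex, hence are
    single leaves. *)
Lemma strong_support_in_branch m x w : e m x -> w \in branch m x -> major e w ->
  exists2 v, v \in branch m x & strong_support e v.
Proof.
have [n] := ubnP #|branch m x|; elim: n => // n IH in m x w *.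
move=> lt_n mx wB Mw.
have sub z : e x z -> z != m -> (exists2 w, w \in branch x z & major e w) ->
    exists2 v, v \in branch m x & strong_support e v.
  move=> xz zm [w' w'B Mw'].
  have lt' : #|branch x z| < n.
    by have := branch_proper mx xz zm; move: lt_n; clear; lia.
  have [v vB sv] := IH x z w' lt' xz w'B Mw'.
  by exists v => //; exact: branch_sub vB.
have [wx|wx] := eqVneq w x; last first.
  by have [z [xz zm wz]] := branch_child mx wB wx; apply: sub xz zm _; exists w.
subst w; have [a [b [xa xb am bm ab]]] := major_nb2 m Mw.
have [/exists_inP/(sub a xa am)//|] := boolP [exists w in branch x a, major e w].
rewrite negb_exists_in => /forall_inP nMa.
have [/exists_inP/(sub b xb bm)//|] := boolP [exists w in branch x b, major e w].
rewrite negb_exists_in => /forall_inP nMb.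
have [la lb] := majorless_fork_leaves xa xb ab nMa nMb.
by exists x; [exact: branch_base | apply/strong_supportP; exists a, b].
Qed.

(** The second neighbour [b] shows that [m] is not a leaf, so the leaves of a strong support vertex
    in the branch stay in the branch. *)
Lemma selected_in_branch m a b w : e m a -> e m b -> a != b ->
  w \in branch m a -> major e w -> exists2 s, s \in selected & s \in branch m a.
Proof.
move=> ma mb ab wB /(strong_support_in_branch ma wB)[v vB].
case/strong_supportP=> y [z [vy vz ly lz yz]].
have inB c : e v c -> leaf e c -> c \in branch m a.
  move=> vc lc; apply: contraT => cB.
  rewrite e_sym in vc; have [cm _] := branch_cross ma cB vB vc.
  by rewrite cm in lc; rewrite (leaf_nb lc ma mb) eqxx in ab.
have /orP[ys|zs] := selected_twins vy vz ly lz yz.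
  by exists y => //; exact: inB.
by exists z => //; exact: inB.
Qed.

Lemma selected_fork m a b : e m a -> e m b -> a != b ->
  exists2 s, s \in selected & (s \in branch m a) || (s \in branch m b).
Proof.
move=> ma mb ab.
have [/exists_inP[w wB Mw]|] := boolP [exists w in branch m a, major e w].
  by have [s sS sB] := selected_in_branch ma mb ab wB Mw; exists s; rewrite ?sB.
rewrite negb_exists_in => /forall_inP nMa.
have [/exists_inP[w wB Mw]|] := boolP [exists w in branch m b, major e w].
  have ba : b != a by rewrite eq_sym.
  have [s sS sB] := selected_in_branch mb ma ba wB Mw.
  by exists s; rewrite ?sB ?orbT.
rewrite negb_exists_in => /forall_inP nMb.
have [la lb] := majorless_fork_leaves ma mb ab nMa nMb.
exact: selected_fork_leaves.
Qed.

Lemma selected_resolving : resolving e selected.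
Proof.
apply: fork_resolving selected_fork; have [r Mr] := has_major.
have [a [b [ra rb _ _ ab]]] := major_nb2 r Mr.
by apply/set0Pn; have [s sS _] := selected_fork ra rb ab; exists s.
Qed.

Lemma metric_dim_le : metric_dim e <= ell' e - #|strong_supports e|.
Proof. by rewrite -card_selected; exact: min_card_le selected_resolving. Qed.

End TwoMajors.

(** * Closing the cycle of implications *)

Lemma mld_number_le_sum : mld_number e <= metric_dim e + domination_number e.
Proof.
have [R resR cR] := min_cardP (resolving_setT e_conn).
have [D domD cD] := min_cardP (dominating_setT e).
rewrite /metric_dim /domination_number -cR -cD.
apply: leq_trans (leq_card_setU R D); apply: min_card_le; apply/andP; split.
  apply/resolvingP=> x y /(resolvingP _ resR)[s sR sxy].
  by exists s; rewrite ?inE ?sR.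
apply/dominatingP=> v; rewrite inE negb_or => /andP[_ vD].
by have [u uD vu] := dominatingP _ domD v vD; exists u; rewrite ?inE ?uD ?orbT.
Qed.

End Tree.

Theorem theorem3 (T : finType) (e : rel T) :
  1 < #|T| -> simple_graph e -> is_tree e -> ~ is_path_graph e ->
  [<-> mld_number e = metric_dim e + domination_number e;
       metric_dim e = ell' e - #|strong_supports e|;
       forall u x : T, exterior_major e u -> 2 <= ter e u ->
         terminal e u x -> e u x;
       forall (x y : T) (p : seq T), leaf e x -> leaf e y -> 2 < dist e x y ->
         path e x p -> last x p = y -> uniq (x :: p) ->
         2 <= #|[set v in x :: p | major e v]| ].
Proof.
move=> T1 [e_sym e_irr] [e_conn e_acyc] nonpath.
have has_major : exists r, major e r.
  apply/existsP; apply: contraT; rewrite negb_exists => /forallP nM.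
  by case: nonpath; exact: majorless_tree_path.
have mld_le := mld_number_le e_sym e_irr e_conn e_acyc has_major.
have mld_ge := mld_number_ge e_sym e_irr e_conn e_acyc has_major.
have dim_ge := metric_dim_ge e_sym e_irr e_conn e_acyc.
tfae.
- move=> mldE; apply/eqP; rewrite eqn_leq dim_ge // andbT.
  by rewrite -(leq_add2r (domination_number e)) -mldE addnC.
- exact: terminals_adjacent.
- exact: leaf_paths_two_majors.
- move=> two_majors; apply/eqP; rewrite eqn_leq mld_number_le_sum //=.
  (* By (iv) the dimension is at most [ell' e - #|strong_supports e|], which turns the lower bound
     for the MLD-number into the missing inequality of (i). *)
  apply: leq_trans mld_ge; rewrite addnC leq_add2l; exact: metric_dim_le.
Qed.
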